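(* Let $(\Omega,\mathcal F)$ be a measurable space, let $\mathcal C\subset\mathcal F$ be a sub-$\sigma$-algebra, and let $\rho:\mathbb F\to\mathbb R$ be a sublinear operator which is continuous from above on $\mathcal F$ and strictly comparable, and whose representation set $\mathcal P$ is stable. Let $\xi\in\mathbb F$ and let $\eta_{ess}:=\operatorname{ess\,sup}_{P\in\mathcal P}E_P[\xi|\mathcal C]$. Then $\eta_{ess}$ is the optimal solution of the problem of minimizing $\rho\big((\xi-\eta)^2\big)$ over $\eta\in\mathbb C$, i.e. $$\rho\big((\xi-\eta_{ess})^2\big)=\inf_{\eta\in\mathbb C}\rho\big((\xi-\eta)^2\big),$$ if and only if $$\inf_{\eta\in\mathbb C}\sup_{\tilde\eta\in\mathbb C^+}\rho\big((\xi-\eta)^2+\tilde\eta(\xi-\eta)\big)=\sup_{\tilde\eta\in\mathbb C^+}\inf_{\eta\in\mathbb C}\rho\big((\xi-\eta)^2+\tilde\eta(\xi-\eta)\big).$$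
   Context: $\mathbb F$ denotes the set of all bounded $\mathcal F$-measurable real functions on $\Omega$, $\mathbb C$ the set of all bounded $\mathcal C$-measurable real functions, and $\mathbb C^+$ the set of nonnegative elements of $\mathbb C$. A sublinear operator is a functional $\rho:\mathbb F\to\mathbb R$ such that: (i) $\rho(\xi_1)\ge\rho(\xi_2)$ if $\xi_1\ge\xi_2$; (ii) $\rho(c)=c$ for $c\in\mathbb R$; (iii) $\rho(\xi_1+\xi_2)\le\rho(\xi_1)+\rho(\xi_2)$ for all $\xi_1,\xi_2\in\mathbb F$; (iv) $\rho(\lambda\xi)=\lambda\rho(\xi)$ for $\lambda\ge0$. $\rho$ is continuous from above on $\mathcal F$ if for each sequence $(\xi_n)\subset\mathbb F$ with $\xi_n\downarrow0$ one has $\rho(\xi_n)\downarrow0$. $\mathcal P$ (the representation set of $\rho$) denotes the set of all linear functionals on $\mathbb F$ dominated by $\rho$. When $\rho$ is continuous from above, every element of $\mathcal P$ is the expectation $E_P$ under a probability measure $P$ on $(\Omega,\mathcal F)$ (and is identified with $P$), $\rho(\xi)=\sup_{P\in\mathcal P}E_P[\xi]$ for $\xi\in\mathbb F$, and there is a probability measure $P_0$ on $(\Omega,\mathcal F)$ such that every $P\in\mathcal P$ is absolutely continuous with respect to $P_0$ and $\{dP/dP_0:P\in\mathcal P\}$ is $\sigma(L^1(P_0),L^\infty(P_0))$-compact; such a $P_0$ is fixed, and the essential supremum is taken with respect to $P_0$. $\rho$ is strictly comparable if for all $\xi_1,\xi_2\in\mathbb F$ satisfying $\xi_1>\xi_2$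 $P_0$-a.s. one has $\rho(\xi_1)>\rho(\xi_2)$. Stability: the space $(\Omega,\mathcal F,P_0)$ is equipped with a filtration $(\mathcal F_n)_{n\ge1}$ such that $\mathcal F=\bigvee_n\mathcal F_n$. Let $\mathcal P^e$ be the set of elements of $\mathcal P$ equivalent to $P_0$, and for $Q\in\mathcal P^e$ put $Z^Q_n=E_{P_0}[dQ/dP_0|\mathcal F_n]$. $\mathcal P$ is stable if for all $Q^0,Q\in\mathcal P^e$ with associated martingales $Z^0_n=Z_n^{Q^0}$, $Z_n=Z_n^Q$, and every stopping time $\tau$, the martingale $L$ given by $L_n=Z^0_n$ for $n\le\tau$ and $L_n=Z^0_\tau Z_n/Z_\tau$ for $n\ge\tau$ defines an element of $\mathcal P$. *)

(* Defs.v *)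
From HB Require Import structures.
From mathcomp Require Import all_boot all_order all_algebra.
From mathcomp Require Import all_classical all_reals all_analysis.

Set Implicit Arguments.
Unset Strict Implicit.
Unset Printing Implicit Defensive.

Import Order.TTheory GRing.Theory Num.Theory.
Import numFieldNormedType.Exports.

Local Open Scope classical_set_scope.
Local Open Scope ring_scope.

(* With S := T this is the space of all bounded measurable functions; with
   S := g_sigma_algebraType C, for C a sub-sigma-algebra, it is the space of
   all bounded C-measurable functions. *)
Definition bounded_measurable {R : realType} d (S : measurableType d) :
    set (S -> R) :=
  [set X : S -> R |
    measurable_fun [set: S] X /\ [bounded X w | w in [set: S]]].
Arguments bounded_measurable {R d} S _.

Definition is_sub_sigma_algebra d (T : measurableType d) (C : set (set T)) : Prop :=
  sigma_algebra [set: T] C /\ C `<=` measurable.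

(* Operators and functionals on the bounded measurable functions are encoded as
   maps on all of T -> R; only their values on bounded_measurable T are ever
   constrained or used. *)

Definition sublinear_operator {R : realType} d (T : measurableType d)
    (rho : (T -> R) -> R) : Prop :=
  [/\ forall X Y, bounded_measurable T X -> bounded_measurable T Y ->
        (forall w, Y w <= X w) -> rho Y <= rho X,
      forall c : R, rho (cst c) = c,
      forall X Y, bounded_measurable T X -> bounded_measurable T Y ->
        rho (X \+ Y) <= rho X + rho Y &
      forall (a : R) X, 0 <= a -> bounded_measurable T X ->
        rho (fun w => a * X w) = a * rho X].

Definition continuous_from_above {R : realType} d (T : measurableType d)
    (rho : (T -> R) -> R) : Prop :=
  forall X : nat -> T -> R, (forall n, bounded_measurable T (X n)) ->
    (forall w, nonincreasing_seq (fun n => X n w)) ->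
    (forall w, X n w @[n --> \oo] --> (0 : R)) ->
    nonincreasing_seq (fun n => rho (X n)) /\
    (rho (X n) @[n --> \oo] --> (0 : R)).

Definition dominated_linear {R : realType} d (T : measurableType d)
    (rho : (T -> R) -> R) : set ((T -> R) -> R) :=
  [set l | (forall (a : R) X Y, bounded_measurable T X ->
              bounded_measurable T Y ->
              l (fun w => a * X w + Y w) = a * l X + l Y) /\
           (forall X, bounded_measurable T X -> l X <= rho X)].

(* The representation set of rho, each dominated linear functional E_P being
   identified with the probability measure P. *)
Definition repr_set {R : realType} d (T : measurableType d)
    (rho : (T -> R) -> R) : set (probability T R) :=
  [set P | dominated_linear rho (fun X => fine 'E_P[X])].

Definition strictly_comparable {R : realType} d (T : measurableType d)
    (P0 : probability T R) (rho : (T -> R) -> R) : Prop :=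
  forall X Y, bounded_measurable T X -> bounded_measurable T Y ->
    {ae P0, forall w, Y w < X w} -> rho Y < rho X.

Definition density {R : realType} d (T : measurableType d)
    (P0 P : probability T R) : T -> R :=
  fun w => fine (Radon_Nikodym (charge_of_finite_measure P) P0 w).

(* L^1(P0) and L^oo(P0) are represented by integrable, resp. essentially
   bounded, functions rather than by their classes: initial topologies do not
   separate P0-a.s. equal functions, so compactness is not affected. *)
Definition L1_pairing {R : realType} d (T : measurableType d)
    (P0 : probability T R) (f : LfunType P0 (lexx 1%E)) :
    {ptws (LfunType P0 (leey 1%E)) -> R} :=
  fun g => Rintegral P0 setT (fun w => f w * g w).

Definition weakly_compact_L1 {R : realType} d (T : measurableType d)
    (P0 : probability T R) (K : set (LfunType P0 (lexx 1%E))) : Prop :=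
  compact (K : set (initial_topology (@L1_pairing R d T P0))).

Definition dominating_measure {R : realType} d (T : measurableType d)
    (rho : (T -> R) -> R) (P0 : probability T R) : Prop :=
  (forall P, repr_set rho P -> P `<< P0) /\
  weakly_compact_L1 [set f : LfunType P0 (lexx 1%E) |
    exists2 P, repr_set rho P & {ae P0, forall w, f w = density P0 P w}].

(* Y is a version of the conditional expectation of X given C under P. *)
Definition is_cond_exp {R : realType} d (T : measurableType d)
    (P : probability T R) (C : set (set T)) (X Y : T -> R) : Prop :=
  [/\ measurable_fun [set: g_sigma_algebraType C] Y,
      P.-integrable setT (EFin \o Y) &
      forall A, C A ->
        (\int[P]_(w in A) (Y w)%:E = \int[P]_(w in A) (X w)%:E)%E].

(* E_P[xi | C] is only determined up to P-null sets, which need not be P0-null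
   when P is not equivalent to P0.  Accordingly eta is an upper bound when it
   dominates E_P[xi | C] P-a.s. (that is, P0-a.s. on the C-measurable set
   {E_P0[dP/dP0 | C] > 0} on which E_P[xi | C] is determined P0-a.s.).  When P
   and P0 are equivalent this is P0-a.s. domination, and the essential supremum
   below is the usual one. *)
Definition cond_exp_upper_bound {R : realType} d (T : measurableType d)
    (Ps : set (probability T R)) (C : set (set T)) (xi eta : T -> R) : Prop :=
  forall P Y, Ps P -> is_cond_exp P C xi Y -> {ae P, forall w, Y w <= eta w}.

Definition is_ess_sup_cond_exp {R : realType} d (T : measurableType d)
    (P0 : probability T R) (Ps : set (probability T R)) (C : set (set T))
    (xi eta : T -> R) : Prop :=
  [/\ measurable_fun [set: g_sigma_algebraType C] eta,
      cond_exp_upper_bound Ps C xi eta &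
      forall zeta : T -> R, measurable_fun [set: g_sigma_algebraType C] zeta ->
        cond_exp_upper_bound Ps C xi zeta ->
        {ae P0, forall w, eta w <= zeta w}].

(* Time is shifted: F n stands for the sigma-algebra of index n + 1. *)
Definition filtration d (T : measurableType d) (F : nat -> set (set T)) : Prop :=
  [/\ forall n, is_sub_sigma_algebra (F n),
      forall m n, (m <= n)%N -> F m `<=` F n &
      (measurable : set (set T)) = <<s \bigcup_n F n >>].

(* None is the value +oo. *)
Definition stopping_time d (T : measurableType d) (F : nat -> set (set T))
    (tau : T -> option nat) : Prop :=
  forall n, F n [set w | exists2 k, tau w = Some k & (k <= n)%N].

Definition density_process {R : realType} d (T : measurableType d)
    (P0 : probability T R) (F : nat -> set (set T)) (Q : probability T R)
    (Z : nat -> T -> R) : Prop :=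
  forall n, is_cond_exp P0 (F n) (density P0 Q) (Z n).

Definition paste {R : realType} {T : Type} (tau : T -> option nat)
    (Z0 Z : nat -> T -> R) (n : nat) (w : T) : R :=
  if tau w is Some k then
    if (n <= k)%N then Z0 n w else Z0 k w * Z n w / Z k w
  else Z0 n w.

Definition equivalent_part {R : realType} d (T : measurableType d)
    (P0 : probability T R) (Ps : set (probability T R)) :
    set (probability T R) :=
  [set Q | [/\ Ps Q, Q `<< P0 & P0 `<< Q]].

Definition stable {R : realType} d (T : measurableType d)
    (P0 : probability T R) (F : nat -> set (set T))
    (Ps : set (probability T R)) : Prop :=
  forall (Q0 Q : probability T R) (Z0 Z : nat -> T -> R) tau,
    equivalent_part P0 Ps Q0 -> equivalent_part P0 Ps Q ->
    density_process P0 F Q0 Z0 -> density_process P0 F Q Z ->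
    stopping_time F tau ->
    exists2 P, Ps P & density_process P0 F P (paste tau Z0 Z).

(* Main.v *)
Require Import Defs.
From HB Require Import structures.
From mathcomp Require Import all_boot all_order all_algebra.
From mathcomp Require Import all_classical all_reals all_analysis.
From mathcomp Require Import measurable_realfun.
From mathcomp Require Import ring lra.

Set Implicit Arguments.
Unset Strict Implicit.
Unset Printing Implicit Defensive.

Import Order.TTheory GRing.Theory Num.Theory.
Import numFieldNormedType.Exports.

Local Open Scope classical_set_scope.
Local Open Scope ring_scope.

(** Write J(eta) = rho((xi - eta)^2) and let L(eta, teta) =
rho((xi - eta)^2 + teta (xi - eta)).  The theorem holds because each side of
the minimax identity can be computed outright: the inf-sup of L is J(eta_ess)
([primal_value]) and the sup-inf of L is the infimum of J over CC
([dual_value]).  Both sides of the equivalence therefore state one and the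
same equality, J(eta_ess) = inf J.

The dual value comes from completing the square: replacing eta by
eta + teta / 2 turns (xi - eta)^2 + teta (xi - eta) into
(xi - eta)^2 - teta^2 / 4.  After this translation of CC a multiplier can only
lower the inner infimum, so teta = 0 is optimal.

For the primal value, teta is a Lagrange multiplier for the constraint
rho(teta (xi - eta)) <= 0 for every teta in CCplus, which says that
E_P[xi | C] <= eta for every P in the representation set.  If eta violates it,
scaling the offending multiplier makes the supremum of L infinite; if eta
satisfies it, the supremum is J(eta), attained at teta = 0.  The element
eta_ess is feasible ([ess_sup_multiplier_le0]), and every feasible eta
dominates it almost surely, by minimality of the essential supremum
([ess_sup_le_feasible]).  Among feasible eta the least one minimizes J, because
(xi - eta_ess)^2 <= (xi - eta)^2 + 2 (eta - eta_ess) (xi - eta_ess)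
and rho of the last term is nonpositive ([mean_square_ess_sup_le]).

Feasibility of eta_ess is the only place where rho has to be represented by
measures.  For A in C, the value rho(1_A (xi - eta_ess)) is attained at some P
of the representation set ([repr_set_attains], by the Hahn-Banach theorem and
continuity from above), and E_P[1_A (xi - eta_ess)] <= 0 follows from
E_P[xi | C] <= eta_ess, the conditional expectation being a Radon-Nikodym
derivative ([cond_exp_exists]).  Indicators 1_A are then replaced by arbitrary
multipliers at the level of rho, by writing a bounded nonnegative function as
a finite sum of multiples of indicators plus a small remainder
([bounded_measurable_peel_ind]). *)

(** * Hahn-Banach theorem for sublinear functionals *)

Definition linear_subspace (R : realType) (V : lmodType R) (D : set V) : Prop :=
  D 0 /\ forall (a : R) x y, D x -> D y -> D (a *: x + y).

Definition sublinear_on (R : realType) (V : lmodType R) (D : set V)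
    (p : V -> R) : Prop :=
  (forall x y, D x -> D y -> p (x + y) <= p x + p y) /\
  (forall a x, 0 <= a -> D x -> p (a *: x) = a * p x).

Lemma linear_subspaceD (R : realType) (V : lmodType R) (D : set V) x y :
  linear_subspace D -> D x -> D y -> D (x + y).
Proof. by move=> [_ DL] Dx Dy; have := DL 1 _ _ Dx Dy; rewrite scale1r. Qed.

Lemma linear_subspaceZ (R : realType) (V : lmodType R) (D : set V) a x :
  linear_subspace D -> D x -> D (a *: x).
Proof. by move=> [D0 DL] Dx; have := DL a _ _ Dx D0; rewrite addr0. Qed.

Lemma linear_subspaceN (R : realType) (V : lmodType R) (D : set V) x :
  linear_subspace D -> D x -> D (- x).
Proof. by move=> DV Dx; rewrite -scaleN1r; exact: linear_subspaceZ. Qed.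

Lemma sublinear_on0 (R : realType) (V : lmodType R) (D : set V) p :
  linear_subspace D -> sublinear_on D p -> p 0 = 0.
Proof. by move=> [D0 _] [_ pZ]; rewrite -(scale0r 0) pZ// mul0r. Qed.

Lemma sublinear_on_geN (R : realType) (V : lmodType R) (D : set V) p x :
  linear_subspace D -> sublinear_on D p -> D x -> - p (- x) <= p x.
Proof.
move=> DV ps Dx; have := ps.1 _ _ Dx (linear_subspaceN DV Dx).
by rewrite subrr (sublinear_on0 DV ps); lra.
Qed.

(** The functional q x = inf over t >= 0 of p (x + t y) - t p y is the directional
derivative of p at the point y in the direction x.  It stays below p (take t = 0)
and is already linear along the line spanned by y, which is what the last
condition says. *)
Lemma sublinear_on_tangent (R : realType) (V : lmodType R) (D : set V) p y :
  linear_subspace D -> sublinear_on D p -> D y ->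
  exists q, [/\ sublinear_on D q, forall x, D x -> q x <= p x &
    q (- y) <= - p y].
Proof.
move=> DV ps Dy.
pose S x := [set p (x + t *: y) - t * p y | t in [set t : R | 0 <= t]].
have DS x t : D x -> D (x + t *: y).
  by move=> Dx; apply: linear_subspaceD => //; exact: linear_subspaceZ.
have S0 x : S x !=set0 by exists (p (x + 0 *: y) - 0 * p y); exists 0 => //=.
have Slb x : D x -> lbound (S x) (- p (- x)).
  move=> Dx _ [t /= t0 <-]; have := ps.1 _ _ (DS _ t Dx) (linear_subspaceN DV Dx).
  by rewrite addrAC subrr add0r (ps.2 t y)//; lra.
have infS x : D x -> has_inf (S x) by move=> Dx; split=> //; exists (- p (- x)); exact: Slb.
have leS x t : D x -> 0 <= t -> inf (S x) <= p (x + t *: y) - t * p y.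
  by move=> Dx t0; apply: ge_inf; [exact: (infS _ Dx).2|exists t].
exists (fun x => inf (S x)); split.
- split=> [u v Du Dv|a u a0 Du].
    rewrite -lerBlDr; apply: lb_le_inf => // _ [t /= t0 <-].
    rewrite lerBlDr -lerBlDl; apply: lb_le_inf => // _ [s /= s0 <-].
    rewrite lerBlDl.
    apply: le_trans (leS _ (t + s) (linear_subspaceD DV Du Dv) (addr_ge0 t0 s0)) _.
    have := ps.1 _ _ (DS _ t Du) (DS _ s Dv).
    by rewrite scalerDl addrACA; lra.
  (* Homogeneity for a > 0 is the change of parameter t |-> a t in the infimum;
  it degenerates at a = 0. *)
  have [->|ane0] := eqVneq a 0.
    rewrite scale0r mul0r; apply/eqP; rewrite eq_le; apply/andP; split.
      have := leS 0 0 DV.1 (lexx _).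
      by rewrite scale0r addr0 mul0r subr0 (sublinear_on0 DV ps).
    apply: lb_le_inf => // _ [t /= t0 <-].
    by rewrite add0r ps.2// subrr.
  have {a0}a0 : 0 < a by rewrite lt0r ane0.
  apply/eqP; rewrite eq_le; apply/andP; split.
    rewrite mulrC -ler_pdivrMr//; apply: lb_le_inf => // _ [t /= t0 <-].
    rewrite ler_pdivrMr// mulrC.
    apply: le_trans (leS _ (a * t) (linear_subspaceZ a DV Du) _) _.
      by rewrite mulr_ge0// ltW.
    by rewrite -scalerA -scalerDr ps.2 ?(ltW a0)//; [lra|exact: DS].
  apply: lb_le_inf => // _ [t /= t0 <-].
  rewrite mulrC -ler_pdivlMr//.
  apply: le_trans (leS _ (a^-1 * t) Du _) _; first by rewrite mulr_ge0// invr_ge0 ltW.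
  have -> : u + (a^-1 * t) *: y = a^-1 *: (a *: u + t *: y).
    by rewrite scalerDr !scalerA mulVf// scale1r.
  rewrite ps.2 ?invr_ge0 ?(ltW a0)//; last exact: DS (linear_subspaceZ _ _ _).
  by rewrite le_eqVlt; apply/orP; left; apply/eqP; field.
- move=> x Dx; have := leS x 0 Dx (lexx _).
  by rewrite scale0r addr0 mul0r subr0.
- have := leS (- y) 1 (linear_subspaceN DV Dy) ler01.
  by rewrite scale1r addNr mul1r (sublinear_on0 DV ps) sub0r.
Qed.

(** Zorn's lemma applies because the pointwise infimum of a chain of sublinear
functionals is sublinear: to bound it at u + v, two members close to the
infimum at u and at v can be replaced by the smaller of the two.  It is finite
because each member is at least - p (- x) at x. *)
Lemma exists_minimal_sublinear (R : realType) (V : lmodType R) (D : set V) p :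
  linear_subspace D -> sublinear_on D p ->
  exists q, [/\ sublinear_on D q, forall x, D x -> q x <= p x &
    forall r, sublinear_on D r -> (forall x, D x -> r x <= q x) ->
      forall x, D x -> q x <= r x].
Proof.
move=> DV ps.
pose X := {q : V -> R | sublinear_on D q /\ forall x, D x -> q x <= p x}.
pose below (q r : X) := `[< forall x, D x -> sval r x <= sval q x >].
pose mkX q hq : X := exist _ q hq.
have p_X : X by exists p; split.
have [|||q qmin] := @ZL_preorder X p_X below.
- by move=> q; apply/asboolP.
- move=> r q s /asboolP rq /asboolP qs; apply/asboolP => x Dx.
  exact: le_trans (qs _ Dx) (rq _ Dx).
- move=> A Atot; have [[q0 Aq0]|A0] := pselect (exists q, A q); last first.
    by exists p_X => s As; case: A0; exists s.
  pose S x := [set sval q x | q in A].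
  have S0 x : S x !=set0 by exists (sval q0 x), q0.
  have infS x : D x -> has_inf (S x).
    move=> Dx; split=> //; exists (- p (- x)) => _ [q Aq <-].
    apply: le_trans (sublinear_on_geN DV (svalP q).1 Dx).
    by rewrite lerN2; apply: (svalP q).2; exact: linear_subspaceN.
  have leS q x : A q -> D x -> inf (S x) <= sval q x.
    by move=> Aq Dx; apply: ge_inf; [exact: (infS _ Dx).2|exists q].
  suff mS : sublinear_on D (fun x => inf (S x)) /\ forall x, D x -> inf (S x) <= p x.
    by exists (mkX _ mS) => q Aq; apply/asboolP => x Dx; exact: leS.
  split=> [|x Dx]; last by apply: le_trans (leS _ _ Aq0 Dx) _; exact: (svalP q0).2.
  split=> [u v Du Dv|a u a0 Du].
    rewrite -lerBlDr; apply: lb_le_inf => // _ [q Aq <-].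
    rewrite lerBlDr -lerBlDl; apply: lb_le_inf => // _ [r Ar <-].
    rewrite lerBlDl.
    have Duv := linear_subspaceD DV Du Dv.
    have [/asboolP qr|/asboolP rq] := Atot _ _ Aq Ar.
      apply: le_trans (leS _ _ Ar Duv) _.
      apply: le_trans ((svalP r).1.1 _ _ Du Dv) _.
      by rewrite lerD2r; exact: qr.
    apply: le_trans (leS _ _ Aq Duv) _.
    apply: le_trans ((svalP q).1.1 _ _ Du Dv) _.
    by rewrite lerD2l; exact: rq.
  have [->|ane0] := eqVneq a 0.
    rewrite scale0r mul0r; suff -> : S 0 = [set 0] by rewrite inf1.
    apply/seteqP; split=> [_ [q Aq <-]|_ ->]; last exists q0 => //.
      exact: (sublinear_on0 DV (svalP q).1).
    exact: (sublinear_on0 DV (svalP q0).1).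
  have {a0}a0 : 0 < a by rewrite lt0r ane0.
  have Dau := linear_subspaceZ a DV Du.
  apply/eqP; rewrite eq_le; apply/andP; split.
    rewrite mulrC -ler_pdivrMr//; apply: lb_le_inf => // _ [q Aq <-].
    by rewrite ler_pdivrMr// mulrC -(svalP q).1.2 ?(ltW a0)//; exact: leS.
  apply: lb_le_inf => // _ [q Aq <-].
  by rewrite (svalP q).1.2 ?(ltW a0)// ler_pM2l//; exact: leS.
- exists (sval q); split; [exact: (svalP q).1|exact: (svalP q).2|].
  move=> r rs rq.
  have rX : sublinear_on D r /\ forall x, D x -> r x <= p x.
    by split=> // x Dx; apply: le_trans (rq _ Dx) _; exact: (svalP q).2.
  by have /asboolP := qmin (mkX _ rX) (asboolT rq).
Qed.

(** By minimality q cannot lie above the functional of [sublinear_on_tangent], so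
q (- x) <= - q x; a sublinear functional that is odd is linear. *)
Lemma minimal_sublinear_linear (R : realType) (V : lmodType R) (D : set V) q :
  linear_subspace D -> sublinear_on D q ->
  (forall r, sublinear_on D r -> (forall x, D x -> r x <= q x) ->
    forall x, D x -> q x <= r x) ->
  forall a x y, D x -> D y -> q (a *: x + y) = a * q x + q y.
Proof.
move=> DV qs qmin.
have qN x : D x -> q (- x) = - q x.
  move=> Dx; have [r [rs rq rN]] := sublinear_on_tangent DV qs Dx.
  have := qmin _ rs rq _ (linear_subspaceN DV Dx).
  by have := sublinear_on_geN DV qs Dx; lra.
have qZ a x : D x -> q (a *: x) = a * q x.
  move=> Dx; have [a0|/ltW a0] := leP 0 a; first exact: qs.2.
  rewrite -[in LHS](opprK a) scaleNr qN; last exact: linear_subspaceZ.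
  by rewrite qs.2 ?oppr_ge0// mulNr opprK.
move=> a x y Dx Dy; have Dax := linear_subspaceZ a DV Dx.
rewrite -qZ//; apply/eqP; rewrite eq_le qs.1//=.
have := qs.1 _ _ (linear_subspaceN DV Dax) (linear_subspaceN DV Dy).
by rewrite -opprD !qN//; [lra|exact: linear_subspaceD].
Qed.

(** Descending to a minimal functional starting from the tangent at y, rather than
from p itself, forces the value p y at y. *)
Lemma hahn_banach_sublinear (R : realType) (V : lmodType R) (D : set V) p y :
  linear_subspace D -> sublinear_on D p -> D y ->
  exists l, [/\ forall a u v, D u -> D v -> l (a *: u + v) = a * l u + l v,
    forall x, D x -> l x <= p x & l y = p y].
Proof.
move=> DV ps Dy; have [q [qs qp qN]] := sublinear_on_tangent DV ps Dy.
have [l [ls lq lmin]] := exists_minimal_sublinear DV qs.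
exists l; split; first exact: minimal_sublinear_linear.
  by move=> x Dx; exact: le_trans (lq _ Dx) (qp _ Dx).
apply/eqP; rewrite eq_le (le_trans (lq _ Dy) (qp _ Dy))/=.
have := sublinear_on_geN DV ls Dy.
by have := lq _ (linear_subspaceN DV Dy); lra.
Qed.

(** * Bounded measurable functions *)

Lemma bounded_measurableP (R : realType) d (S : measurableType d) (X : S -> R) :
  bounded_measurable S X <->
  measurable_fun [set: S] X /\ exists M, forall w, `|X w| <= M.
Proof.
split=> -[mX]; last first.
  move=> [M XM]; split=> //; exists M; split; first exact: num_real.
  by move=> y /ltW My w _; exact: le_trans (XM w) My.
move=> [M [_ XM]]; split=> //; exists (M + 1) => w.
by apply: XM => //; rewrite ltrDl.
Qed.

Lemma bounded_measurable_cst (R : realType) d (S : measurableType d) (c : R) :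
  bounded_measurable S (fun=> c).
Proof. by apply/bounded_measurableP; split=> //; exists `|c|. Qed.

Lemma bounded_measurableD (R : realType) d (S : measurableType d)
    (X Y : S -> R) : bounded_measurable S X -> bounded_measurable S Y ->
  bounded_measurable S (fun w => X w + Y w).
Proof.
move=> /bounded_measurableP[mX [M XM]] /bounded_measurableP[mY [N YN]].
apply/bounded_measurableP; split; first exact: measurable_funD.
by exists (M + N) => w; apply: le_trans (ler_normD _ _) _; exact: lerD.
Qed.

Lemma bounded_measurableM (R : realType) d (S : measurableType d)
    (X Y : S -> R) : bounded_measurable S X -> bounded_measurable S Y ->
  bounded_measurable S (fun w => X w * Y w).
Proof.
move=> /bounded_measurableP[mX [M XM]] /bounded_measurableP[mY [N YN]].
apply/bounded_measurableP; split; first exact: measurable_funM.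
by exists (M * N) => w; rewrite normrM; exact: ler_pM.
Qed.

Lemma bounded_measurableZ (R : realType) d (S : measurableType d) (a : R)
    (X : S -> R) : bounded_measurable S X ->
  bounded_measurable S (fun w => a * X w).
Proof. exact/bounded_measurableM/bounded_measurable_cst. Qed.

Lemma bounded_measurableB (R : realType) d (S : measurableType d)
    (X Y : S -> R) : bounded_measurable S X -> bounded_measurable S Y ->
  bounded_measurable S (fun w => X w - Y w).
Proof.
move=> bX bY; rewrite (_ : (fun w => _) = fun w => X w + -1 * Y w).
  by apply: bounded_measurableD => //; exact: bounded_measurableZ.
by apply/funext => w; rewrite mulN1r.
Qed.

Lemma bounded_measurableX2 (R : realType) d (S : measurableType d)
    (X : S -> R) : bounded_measurable S X ->
  bounded_measurable S (fun w => X w ^+ 2).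
Proof. by move=> bX; exact: bounded_measurableM. Qed.

Lemma bounded_measurable_max0 (R : realType) d (S : measurableType d)
    (X : S -> R) : bounded_measurable S X ->
  bounded_measurable S (fun w => Num.max (X w) 0).
Proof.
move=> /bounded_measurableP[mX [M XM]].
apply/bounded_measurableP; split; first exact: measurable_maxr.
exists M => w; apply: le_trans (XM w).
by case: (leP (X w) 0) => // _; rewrite normr0.
Qed.

Lemma bounded_measurable_indic (R : realType) d (S : measurableType d)
    (A : set S) : measurable A -> bounded_measurable S (\1_A : S -> R).
Proof.
move=> mA; apply/bounded_measurableP; split; first exact: measurable_indic.
by exists 1 => w; rewrite indicE ger0_norm// lern1 leq_b1.
Qed.

Lemma measurable_set_ler (R : realType) d (S : measurableType d)
    (X Y : S -> R) : measurable_fun [set: S] X -> measurable_fun [set: S] Y ->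
  measurable [set w | X w <= Y w].
Proof.
move=> mX mY; have := measurable_fun_ler mX mY measurableT (_ : measurable [set true]).
by rewrite setTI; exact.
Qed.

(** Induction principle replacing approximation by simple functions: a property
that holds for functions with values in [0, e] and is preserved by adding
e times an indicator holds for every nonnegative bounded function.  If X takes
values in [0, (n + 2) e], subtracting e on the set where X >= e leaves a
function with values in [0, (n + 1) e], so finitely many steps suffice. *)
Lemma bounded_measurable_peel_ind (R : realType) d (S : measurableType d)
    (e : R) (Q : (S -> R) -> Prop) : 0 < e ->
  (forall X, bounded_measurable S X -> (forall w, 0 <= X w <= e) -> Q X) ->
  (forall X A, bounded_measurable S X -> measurable A -> Q X ->
    Q (fun w => X w + e * \1_A w)) ->
  forall X, bounded_measurable S X -> (forall w, 0 <= X w) -> Q X.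
Proof.
move=> e0 Qsmall Qstep X bX X0.
have [n Xn] : exists n, forall w, X w <= n.+1%:R * e.
  have /bounded_measurableP[_ [M XM]] := bX.
  exists (Num.truncn (M / e)) => w.
  rewrite -ler_pdivrMr// (le_trans _ (ltW (truncnS_gt _)))//.
  by rewrite ler_pM2r ?invr_gt0// (le_trans (ler_norm _)).
elim: n X bX X0 Xn => [|n IH] X bX X0 Xn.
  by apply: Qsmall => // w; rewrite X0 (le_trans (Xn w))// mul1r.
pose A := [set w | e <= X w].
have mA : measurable A.
  by apply: measurable_set_ler => //; case: bX.
have -> : X = fun w => (X w - e * \1_A w) + e * \1_A w.
  by apply/funext => w; rewrite subrK.
have bX' : bounded_measurable S (fun w => X w - e * \1_A w).
  apply: bounded_measurableB => //; apply: bounded_measurableZ.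
  exact: bounded_measurable_indic.
apply: Qstep => //; apply: IH => // w; rewrite indicE.
  have [/set_mem/= eX|_] := boolP (w \in A); first by rewrite mulr1 subr_ge0.
  by rewrite mulr0 subr0.
have [_|/negP Xe] := boolP (w \in A).
  by have := Xn w; rewrite mulr1 -(natr1 n.+1); lra.
have {}Xe : X w < e by rewrite ltNge; apply/negP => eX; apply: Xe; exact/mem_set.
rewrite mulr0 subr0 (le_trans (ltW Xe))// ler_peMl ?(ltW e0)//.
by rewrite ler1n.
Qed.

(** * Representation of dominated linear functionals by probability measures *)

Lemma bounded_measurable_integrable (R : realType) d (T : measurableType d)
    (P : probability T R) (X : T -> R) (A : set T) :
  bounded_measurable T X -> measurable A -> P.-integrable A (EFin \o X).
Proof.
move=> [mX bX] mA; apply: (integrableS measurableT) => //.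
apply: measurable_bounded_integrable => //.
by apply: (le_lt_trans (probability_le1 P measurableT)); rewrite ltry.
Qed.

Lemma expectation_Rintegral (R : realType) d (T : measurableType d)
    (P : probability T R) (X : T -> R) :
  fine 'E_P[X] = \int[P]_w X w.
Proof. by rewrite unlock. Qed.

Lemma fine_expectation_linear (R : realType) d (T : measurableType d)
    (P : probability T R) (a : R) (X Y : T -> R) :
  bounded_measurable T X -> bounded_measurable T Y ->
  fine 'E_P[fun w => a * X w + Y w] = a * fine 'E_P[X] + fine 'E_P[Y].
Proof.
move=> bX bY; rewrite !expectation_Rintegral RintegralD//; first last.
- exact: bounded_measurable_integrable.
- by apply: bounded_measurable_integrable => //; exact: bounded_measurableZ.
- by rewrite RintegralZl//; exact: bounded_measurable_integrable.
Qed.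

Section linear_functional.
Variables (R : realType) (d : measure_display) (T : measurableType d).
Variables (rho l : (T -> R) -> R).
Hypotheses (rho_sub : sublinear_operator rho) (l_rho : dominated_linear rho l).

Lemma dominated_linearL (a : R) X Y :
  bounded_measurable T X -> bounded_measurable T Y ->
  l (fun w => a * X w + Y w) = a * l X + l Y.
Proof. by move: l_rho => [lL _]; exact: lL. Qed.

Lemma dominated_linearD X Y :
  bounded_measurable T X -> bounded_measurable T Y ->
  l (fun w => X w + Y w) = l X + l Y.
Proof.
move=> bX bY; rewrite -[l X]mul1r -dominated_linearL//.
by congr l; apply/funext => w; rewrite mul1r.
Qed.

Lemma dominated_linearB X Y :
  bounded_measurable T X -> bounded_measurable T Y ->
  l (fun w => X w - Y w) = l X - l Y.
Proof.
move=> bX bY; rewrite addrC -mulN1r -dominated_linearL//.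
by congr l; apply/funext => w; rewrite mulN1r addrC.
Qed.

Lemma le_dominated_linear X Y :
  bounded_measurable T X -> bounded_measurable T Y ->
  (forall w, X w <= Y w) -> l X <= l Y.
Proof.
move=> bX bY XY; rewrite -subr_le0 -dominated_linearB//.
have bXY := bounded_measurableB bX bY.
apply: le_trans (l_rho.2 _ bXY) _.
case: rho_sub => rho_mono rho_cst _ _; rewrite -(rho_cst 0).
by apply: rho_mono => // [|w]; [exact: bounded_measurable_cst|rewrite subr_le0].
Qed.

(** Both l c <= rho c = c and l (- c) <= rho (- c) = - c hold. *)
Lemma dominated_linear_cst (c : R) : l (fun=> c) = c.
Proof.
have le_cst a : l (fun=> a) <= a.
  have := l_rho.2 _ (bounded_measurable_cst T a).
  by case: rho_sub => _ -> _ _.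
have lN : l (fun=> - c) = - l (fun=> c).
  apply/eqP; rewrite -addr_eq0 -dominated_linearD; [|exact: bounded_measurable_cst..].
  rewrite addNr; have bc := bounded_measurable_cst T (0 : R).
  by have := dominated_linearB bc bc; rewrite !subrr => ->.
by have := le_cst c; have := le_cst (- c); rewrite lN; lra.
Qed.

Hypothesis rho_cont : continuous_from_above rho.

Lemma indic_ge0 (A : set T) w : 0 <= \1_A w :> R.
Proof. by rewrite indicE. Qed.

Lemma dominated_linear_indic_ge0 (A : set T) :
  measurable A -> 0 <= l (\1_A : T -> R).
Proof.
move=> mA; rewrite -(dominated_linear_cst 0); apply: le_dominated_linear.
- exact: bounded_measurable_cst.
- exact: bounded_measurable_indic.
- by move=> w; exact: indic_ge0.
Qed.

(** The tails of the union decrease to the empty set, so l of their indicators,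
which lies between 0 and rho, tends to 0 by continuity from above. *)
Lemma dominated_linear_indic_sigma_additive (F : nat -> set T) :
  (forall n, measurable (F n)) -> trivIset setT F ->
  \sum_(0 <= i < n) l (\1_(F i) : T -> R) @[n --> \oo] -->
    l (\1_(\bigcup_n F n) : T -> R).
Proof.
move=> mF tF.
(* D n is the union of the F i for n <= i, hence D n = F n + D n.+1 as a
disjoint union. *)
pose D n := \bigcup_(i in [set i | (n <= i)%N]) F i.
have mD n : measurable (D n) by exact: bigcup_measurable.
have bD n : bounded_measurable T (\1_(D n) : T -> R).
  exact: bounded_measurable_indic.
have DS n w : \1_(D n) w = \1_(F n) w + \1_(D n.+1) w :> R.
  rewrite !indicE; have [/set_mem Fw|/negP Fw] := boolP (w \in F n).
    rewrite (mem_set (_ : D n w)); last by exists n => /=.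
    rewrite memNset ?addr0// => -[i /= ni Fiw].
    have ni_eq : n = i by apply: tF => //; exists w.
    by rewrite -ni_eq ltnn in ni.
  rewrite add0r; congr (_%:R); congr nat_of_bool; apply/idP/idP => /set_mem.
    move=> [i /=]; rewrite leq_eqVlt => /orP[/eqP <-|ni] Fiw.
      by case: Fw; exact/mem_set.
    by apply/mem_set; exists i.
  by move=> [i /= ni Fiw]; apply/mem_set; exists i => //=; exact: ltnW.
have lD n : l (\1_(\bigcup_n F n) : T -> R) - l (\1_(D n) : T -> R) =
    \sum_(0 <= i < n) l (\1_(F i) : T -> R).
  elim: n => [|n IH].
    rewrite big_geq//; apply/eqP; rewrite subr_eq0; apply/eqP.
    by congr (l (\1_ _)); apply: eq_bigcupl; split.
  rewrite big_nat_recr//= -IH.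
  have -> : l (\1_(D n)) = l (\1_(F n)) + l (\1_(D n.+1)).
    rewrite -dominated_linearD//; last exact: bounded_measurable_indic.
    by congr l; apply/funext => w; rewrite DS.
  by lra.
have D0 : l (\1_(D n) : T -> R) @[n --> \oo] --> 0.
  have [||_ rhoD] := rho_cont bD.
  - move=> w; apply/nonincreasing_seqP => n.
    by rewrite (DS n) lerDr indic_ge0.
  - move=> w; apply: cvg_near_cst.
    have [[i _ Fiw]|Uw] := pselect ((\bigcup_n F n) w).
      exists i.+1 => //= n /= ni; rewrite indicE memNset// => -[j /= nj Fjw].
      have ij : i = j by apply: tF => //; exists w.
      by move: ni; rewrite ij ltnNge nj.
    by near=> n; rewrite indicE memNset// => -[j _ Fjw]; apply: Uw; exists j.
  apply: squeeze_cvgr rhoD; last exact: cvg_cst.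
  by near=> n; rewrite dominated_linear_indic_ge0//=; exact: l_rho.2.
rewrite (_ : (fun n => _) =
    fun n => l (\1_(\bigcup_n F n) : T -> R) - l (\1_(D n) : T -> R)).
  by rewrite -[X in _ --> X]subr0; apply: cvgB => //; exact: cvg_cst.
by apply/funext => n; rewrite lD.
Unshelve. all: by end_near.
Qed.

Lemma dominated_linear_probability : exists P : probability T R,
  forall A, measurable A -> P A = (l (\1_A : T -> R))%:E.
Proof.
(* A measure has to be nonnegative on all sets, whereas l is under control only
on indicators of measurable ones: hence the truncation at 0. *)
pose m (A : set T) : \bar R := (Num.max (l (\1_A : T -> R)) 0)%:E.
have mE A : measurable A -> m A = (l (\1_A : T -> R))%:E.
  move=> mA; rewrite /m; congr EFin.
  by apply/max_idPl; exact: dominated_linear_indic_ge0.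
have m0 : m set0 = 0%E.
  rewrite mE// (_ : \1_set0 = fun=> 0) ?dominated_linear_cst//.
  by apply/funext => w; rewrite indicE in_set0.
have m_ge0 A : (0 <= m A)%E by rewrite lee_fin le_max lexx orbT.
have mT : m setT = 1%E.
  rewrite mE// (_ : \1_setT = fun=> 1) ?dominated_linear_cst//.
  by apply/funext => w; rewrite indicE in_setT.
have m_sigma : semi_sigma_additive m.
  move=> F mF tF mUF; rewrite mE//; apply: cvg_EFin.
    by near=> n; rewrite (_ : \sum_(0 <= i < n) m (F i) =
      (\sum_(0 <= i < n) Num.max (l (\1_(F i) : T -> R)) 0)%:E) ?sumEFin.
  rewrite (_ : _ \o _ = fun n => \sum_(0 <= i < n) l (\1_(F i) : T -> R)).
    exact: dominated_linear_indic_sigma_additive.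
  apply/funext => n /=; under eq_bigr do rewrite mE//.
  by rewrite sumEFin.
pose mu : {measure set T -> \bar R} :=
  HB.pack m (isMeasure.Build _ _ _ m m0 m_ge0 m_sigma).
have muT : mu setT = 1%E by [].
pose P : probability T R := HB.pack_for (probability T R) (Measure.sort mu)
  (Measure_isProbability.Build _ _ _ mu muT).
by exists P => A mA; rewrite -mE.
Unshelve. all: by end_near.
Qed.

(** Two linear monotone functionals that agree on constants and indicators differ by at most e on
functions with values in [0, e], and the difference does not change when a
multiple of an indicator is added. *)
Lemma dominated_linear_expectation : exists P : probability T R,
  forall X, bounded_measurable T X -> fine 'E_P[X] = l X.
Proof.
have [P PE] := dominated_linear_probability; exists P.
have ge0E X : bounded_measurable T X -> (forall w, 0 <= X w) ->
    fine 'E_P[X] = l X.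
  move=> bX X0; apply/eqP; rewrite -subr_eq0 -normr_le0.
  apply/ler_addgt0Pr => e e0; rewrite add0r.
  apply: (bounded_measurable_peel_ind (e := e)
    (Q := fun X => `|fine 'E_P[X] - l X| <= e)) X bX X0 => //.
    move=> X bX X0e.
    have bc (c : R) := bounded_measurable_cst T c.
    have lX0 : 0 <= l X.
      rewrite -(dominated_linear_cst 0); apply: le_dominated_linear => // w.
      by case/andP: (X0e w).
    have lXe : l X <= e.
      rewrite -(dominated_linear_cst e); apply: le_dominated_linear => // w.
      by case/andP: (X0e w).
    have EX0 : 0 <= fine 'E_P[X].
      rewrite expectation_Rintegral; apply: Rintegral_ge0 => w _.
      by case/andP: (X0e w).
    have EXe : fine 'E_P[X] <= e.
      rewrite expectation_Rintegral (@le_trans _ _ (\int[P]_w e))//.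
        apply: le_Rintegral => //; [exact: bounded_measurable_integrable..|].
        by move=> w _; case/andP: (X0e w).
      by rewrite Rintegral_cst//= probability_setT mulr1.
    by rewrite ler_norml; apply/andP; split; lra.
  move=> X A bX mA; have bA := @bounded_measurable_indic R _ T A mA.
  rewrite (_ : (fun w => _) = fun w => e * \1_A w + X w).
    rewrite fine_expectation_linear// dominated_linearL//.
    by rewrite expectation_indic// PE//= opprD addrACA subrr add0r.
  by apply/funext => w; rewrite addrC.
move=> X bX; have /bounded_measurableP[_ [M XM]] := bX.
have bM := bounded_measurable_cst T M.
have XM0 w : 0 <= X w + M by have := XM w; rewrite ler_norml => /andP[]; lra.
have := ge0E _ (bounded_measurableD bX bM) XM0.
rewrite dominated_linearD// dominated_linear_cst.
have := fine_expectation_linear P 1 bX bM.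
rewrite (_ : (fun w => _) = fun w => X w + M) ?expectation_cst/=; first lra.
by apply/funext => w; rewrite mul1r.
Qed.

End linear_functional.

(** The supremum in the dual representation of rho is a maximum: a linear
functional dominated by rho and touching it at Y exists by the Hahn-Banach
theorem, and continuity from above makes it an expectation. *)
Lemma repr_set_attains (R : realType) d (T : measurableType d)
    (rho : (T -> R) -> R) (Y : T -> R) :
  sublinear_operator rho -> continuous_from_above rho ->
  bounded_measurable T Y ->
  exists2 P, repr_set rho P & fine 'E_P[Y] = rho Y.
Proof.
move=> rho_sub rho_cont bY.
have sD : linear_subspace (bounded_measurable T : set (T -> R)).
  split=> [|a X Z bX bZ]; first exact: bounded_measurable_cst.
  by apply: bounded_measurableD => //; exact: bounded_measurableZ.
have rD : sublinear_on (bounded_measurable T : set (T -> R)) rho.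
  by case: rho_sub => _ _ rhoD rhoZ; split=> *; [exact: rhoD|exact: rhoZ].
have [l [lL l_rho lY]] := hahn_banach_sublinear sD rD bY.
have dl : dominated_linear rho l by split.
have [P PE] := dominated_linear_expectation rho_sub dl rho_cont.
exists P; last by rewrite PE.
split=> [a X Z bX bZ|X bX]; first exact: fine_expectation_linear.
by rewrite PE//; exact: l_rho.
Qed.

(** * Conditional expectations given a sub-sigma-algebra *)

Section sub_sigma_algebra.
Variables (R : realType) (d : measure_display) (T : measurableType d).
Variables (C : set (set T)) (C_sub : is_sub_sigma_algebra C).
Local Notation S := (g_sigma_algebraType C).

Lemma measurable_subE : (measurable : set (set S)) = C.
Proof. by case: C_sub => sC _; exact: sigma_algebra_id. Qed.

Lemma measurable_sub (A : set T) : C A -> measurable A.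
Proof. by case: C_sub => _; exact. Qed.

Lemma measurable_fun_sub_id : measurable_fun [set: T] (id : T -> S).
Proof.
by move=> _ A; rewrite measurable_subE setTI preimage_id; exact: measurable_sub.
Qed.

Lemma measurable_fun_sub d' (U : measurableType d') (f : T -> U) :
  measurable_fun [set: S] f -> measurable_fun [set: T] f.
Proof. by move=> mf; exact: (measurableT_comp mf measurable_fun_sub_id). Qed.

Lemma bounded_measurable_sub (X : T -> R) :
  bounded_measurable S X -> bounded_measurable T X.
Proof. by move=> [mX bX]; split=> //; exact: measurable_fun_sub. Qed.

Lemma measurable_fun_sub_ler (X Y : T -> R) :
  measurable_fun [set: S] X -> measurable_fun [set: S] Y ->
  C [set w | X w <= Y w].
Proof.
by move=> mX mY; have := measurable_set_ler mX mY; rewrite measurable_subE.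
Qed.

(** The conditional expectation is the Radon-Nikodym derivative of the charge
A |-> E_P[X; A], restricted to C, with respect to the restriction of P to C.
Both restrictions are set functions on the measurable type generated by C, and
integrals are carried back to T as integrals against an image measure under
the identity map. *)
Lemma cond_exp_exists (P : probability T R) (X : T -> R) :
  P.-integrable setT (EFin \o X) -> exists Y, is_cond_exp P C X Y.
Proof.
move=> intX; pose idC : T -> S := id.
have mid : measurable_fun [set: T] idC := measurable_fun_sub_id.
have mS (A : set S) : measurable A -> d.-measurable A.
  by rewrite measurable_subE; exact: measurable_sub.
pose m : set S -> \bar R := pushforward P idC.
have m0 : m set0 = 0%E by exact: (measure0 P).
have m_ge0 A : (0 <= m A)%E by exact: (measure_ge0 P).
have m_sigma : semi_sigma_additive m.
  move=> F mF tF mUF; apply: (measure_semi_sigma_additive (s := P)) => //.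
  - by move=> i; exact: (mS (F i)) (mF i).
  - exact: mS mUF.
pose PS : {measure set S -> \bar R} :=
  HB.pack m (isMeasure.Build _ _ _ m m0 m_ge0 m_sigma).
have PST : PS setT = 1%E by exact: (probability_setT P).
pose Q : probability S R := HB.pack_for (probability S R) (Measure.sort PS)
  (Measure_isProbability.Build _ _ _ PS PST).
pose n : set S -> \bar R := induced_charge intX.
have n0 : n set0 = 0%E by exact: (charge0 (induced_charge intX)).
have n_fin A : measurable A -> n A \is a fin_num.
  by move=> mA; apply: (fin_num_measure (induced_charge intX)); exact: mS.
have n_sigma : semi_sigma_additive n.
  move=> F mF tF mUF.
  apply: (charge_semi_sigma_additive (s := induced_charge intX)) => //.
  - by move=> i; exact: (mS (F i)) (mF i).
  - exact: mS mUF.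
pose nu : {charge set S -> \bar R} :=
  HB.pack n (isCharge.Build _ _ _ n n0 n_fin n_sigma).
have nuQ : nu `<< Q.
  apply/null_content_dominatesP => A mA QA0.
  apply: null_set_integral => //; first exact: mS.
  by apply: measurable_funTS; exact: (measurable_int _ intX).
pose Y w := fine (Radon_Nikodym nu Q w).
have YE : EFin \o Y = Radon_Nikodym nu Q.
  by apply/funext => w /=; rewrite fineK// Radon_Nikodym_fin_num.
have intY : Q.-integrable setT (EFin \o Y).
  by rewrite YE; exact: Radon_Nikodym_integrable.
have mY : measurable_fun [set: S] Y.
  by apply/measurable_EFinP; exact: (measurable_int _ intY).
have intYP : P.-integrable setT (EFin \o Y).
  apply/integrableP; split; first exact/measurable_EFinP/measurable_fun_sub.
  have /integrableP[_] := intY.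
  rewrite (ge0_integral_pushforward mid P)//.
  by apply: measurableT_comp => //; exact/measurable_EFinP.
exists Y; split=> // A CA.
have mA : measurable (A : set S) by rewrite measurable_subE.
have := Radon_Nikodym_integral nuQ mA; rewrite -YE => nuA.
transitivity (nu A) => //; rewrite nuA [RHS](integral_pushforward mid) //.
- exact/measurable_EFinP.
- by apply: integrableS intYP => //; exact: mS.
Qed.

End sub_sigma_algebra.

(** * The constraint dual to nonnegative multipliers *)

(** Adding e > 0 to Y turns an almost sure inequality into a strict one, to which
strict comparability applies. *)
Lemma le_sublinear_ae (R : realType) d (T : measurableType d)
    (rho : (T -> R) -> R) (P0 : probability T R) X Y :
  sublinear_operator rho -> strictly_comparable P0 rho ->
  bounded_measurable T X -> bounded_measurable T Y ->
  {ae P0, forall w, X w <= Y w} -> rho X <= rho Y.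
Proof.
move=> [_ rho_cst rhoD _] rho_lt bX bY XY; apply/ler_addgt0Pr => e e0.
have be := bounded_measurable_cst T e.
rewrite -[e in leRHS]rho_cst (le_trans _ (rhoD _ _ bY be))//.
apply/ltW/rho_lt => //; first exact: bounded_measurableD.
by apply: filterS XY => w XYw; rewrite /= (le_lt_trans XYw)// ltrDl.
Qed.

Lemma fine_expectation_indicM (R : realType) d (T : measurableType d)
    (P : probability T R) (A : set T) (X : T -> R) :
  fine 'E_P[fun w => \1_A w * X w] = \int[P]_(w in A) X w.
Proof.
rewrite expectation_Rintegral [RHS]Rintegral_mkcond.
by apply: eq_Rintegral => w _; rewrite patchE indicE; case: ifP; rewrite ?mul1r ?mul0r.
Qed.

Section constraint.
Variables (R : realType) (d : measure_display) (T : measurableType d).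
Variables (C : set (set T)) (C_sub : is_sub_sigma_algebra C).
Local Notation S := (g_sigma_algebraType C).
Variables (rho : (T -> R) -> R) (xi : T -> R).
Hypotheses (rho_sub : sublinear_operator rho) (xi_bd : bounded_measurable T xi).

Lemma Rintegral_cond_exp (P : probability T R) (Y : T -> R) (A : set T) :
  is_cond_exp P C xi Y -> C A ->
  \int[P]_(w in A) Y w = \int[P]_(w in A) xi w.
Proof. by move=> [_ _ YE] CA; congr fine; exact: YE. Qed.

(** On A in C the integrals of xi and of its conditional expectation coincide. *)
Lemma Rintegral_le_cond_exp_bound (P : probability T R) (Y eta : T -> R)
    (A : set T) :
  bounded_measurable S eta -> is_cond_exp P C xi Y ->
  {ae P, forall w, Y w <= eta w} -> C A ->
  \int[P]_(w in A) xi w <= \int[P]_(w in A) eta w.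
Proof.
move=> /(bounded_measurable_sub C_sub) beta YE [N [mN PN0 YN]] CA.
have mA := measurable_sub C_sub CA.
have intY : P.-integrable A (EFin \o Y).
  by case: YE => _ intY _; exact: integrableS intY.
have inteta := bounded_measurable_integrable P beta mA.
have mAN : measurable (A `\` N) by exact: measurableD.
have AN : A `\` N `<=` A by exact: subDsetl.
rewrite -(Rintegral_cond_exp YE CA) /Rintegral.
rewrite (negligible_integral mN mA intY)// (negligible_integral mN mA inteta)//.
apply: le_Rintegral => //; [exact: integrableS intY|exact: integrableS inteta|].
by move=> w [_]; apply: contra_notT => Yw; apply: YN; exact/negP.
Qed.

Lemma sublinear_indicM_le0 (eta : T -> R) (A : set T) :
  continuous_from_above rho -> bounded_measurable S eta ->
  cond_exp_upper_bound (repr_set rho) C xi eta -> C A ->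
  rho (fun w => \1_A w * (xi w - eta w)) <= 0.
Proof.
move=> rho_cont beta eta_ub CA.
have mA := measurable_sub C_sub CA.
have betaT := bounded_measurable_sub C_sub beta.
have bX : bounded_measurable T (fun w => \1_A w * (xi w - eta w)).
  apply: bounded_measurableM; first exact: bounded_measurable_indic.
  exact: bounded_measurableB.
have [P PP <-] := repr_set_attains rho_sub rho_cont bX.
have [Y YE] := cond_exp_exists C_sub (bounded_measurable_integrable P xi_bd measurableT).
rewrite fine_expectation_indicM RintegralB//; [|exact: bounded_measurable_integrable..].
by rewrite subr_le0; exact: Rintegral_le_cond_exp_bound (eta_ub _ _ PP YE) CA.
Qed.

(** With X <= K, peeling multiples of e / K off teta keeps
rho (teta X) <= e: a remainder with values in [0, e / K] contributes at most e,
and each indicator contributes a nonpositive amount by subadditivity. *)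
Lemma sublinear_multiplier_le0 (X teta : T -> R) :
  bounded_measurable T X ->
  (forall A, C A -> rho (fun w => \1_A w * X w) <= 0) ->
  bounded_measurable S teta -> (forall w, 0 <= teta w) ->
  rho (fun w => teta w * X w) <= 0.
Proof.
case: rho_sub => rho_mono rho_cst rhoD rhoZ bX rho_indic bteta teta0.
have /bounded_measurableP[_ [M XM]] := bX.
apply/ler_addgt0Pr => e e0; rewrite add0r.
have M1 : 0 < `|M| + 1 by rewrite ltr_wpDl.
have XM1 w : X w <= `|M| + 1.
  apply: le_trans (ler_norm _) _; apply: le_trans (XM w) _.
  by apply: le_trans (ler_norm _) _; rewrite lerDl.
have bM (Z : T -> R) : bounded_measurable S Z ->
    bounded_measurable T (fun w => Z w * X w).
  by move=> bZ; apply: bounded_measurableM => //; exact: bounded_measurable_sub bZ.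
apply: (@bounded_measurable_peel_ind R _ S (e / (`|M| + 1))
  (fun Z => rho (fun w => Z w * X w) <= e)) teta bteta teta0.
- by rewrite divr_gt0.
- move=> Z bZ Z0; rewrite -[leRHS]rho_cst; apply: rho_mono => [||w].
  + exact: bounded_measurable_cst.
  + exact: bM.
  + have /andP[Zw0 Zwe] := Z0 w.
    apply: le_trans (ler_wpM2l Zw0 (XM1 w)) _.
    by rewrite -ler_pdivlMr.
- move=> Z A bZ; rewrite (measurable_subE C_sub) => CA rhoZX.
  have b1A : bounded_measurable S (\1_A : T -> R).
    by apply: bounded_measurable_indic; rewrite (measurable_subE C_sub).
  rewrite (_ : (fun w => _) =
    (fun w => Z w * X w) \+ (fun w => e / (`|M| + 1) * (\1_A w * X w))).
    apply: le_trans (rhoD _ _ _ _) _; [exact: bM| |].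
      by apply: bounded_measurableZ; exact: bM.
    rewrite rhoZ; [|by rewrite divr_ge0// ltW|exact: bM].
    rewrite -[leRHS]addr0 lerD// mulr_ge0_le0//; last exact: rho_indic.
    by rewrite divr_ge0// ltW.
  by apply/funext => w /=; rewrite mulrDl mulrA.
Qed.

(** Test the constraint on the set A where eta < E_P[xi | C]: it belongs to C, and
the integral over A of the positive function E_P[xi | C] - eta is nonpositive,
so A is negligible. *)
Lemma feasible_cond_exp_upper_bound (eta : T -> R) :
  bounded_measurable S eta ->
  (forall A, C A -> rho (fun w => \1_A w * (xi w - eta w)) <= 0) ->
  cond_exp_upper_bound (repr_set rho) C xi eta.
Proof.
move=> beta rho_le0 P Y [_ P_rho] YE.
have betaT := bounded_measurable_sub C_sub beta.
pose A := ~` [set w | Y w <= eta w].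
have [mY intYT _] := YE.
have CA : C A.
  rewrite -(measurable_subE C_sub); apply: measurableC.
  by rewrite (measurable_subE C_sub); apply: measurable_fun_sub_ler => //; case: beta.
have mA := measurable_sub C_sub CA.
have intY : P.-integrable A (EFin \o Y) by exact: integrableS intYT.
have inteta := bounded_measurable_integrable P betaT mA.
have intxi := bounded_measurable_integrable P xi_bd mA.
have bX : bounded_measurable T (fun w => \1_A w * (xi w - eta w)).
  apply: bounded_measurableM; first exact: bounded_measurable_indic.
  exact: bounded_measurableB.
have int_le0 : \int[P]_(w in A) (Y w - eta w) <= 0.
  rewrite RintegralB// (Rintegral_cond_exp YE CA) -RintegralB//.
  by rewrite -fine_expectation_indicM; apply: le_trans (P_rho _ bX) _; exact: rho_le0.
have YA w : A w -> 0 < Y w - eta w by move=> /negP; rewrite -ltNge subr_gt0.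
have intB : P.-integrable A (EFin \o (Y \- eta)).
  by rewrite (_ : _ \o _ = (EFin \o Y) \- (EFin \o eta))%E //; exact: integrableB.
have int0 : (\int[P]_(w in A) `|(Y w - eta w)%:E| = 0)%E.
  rewrite (eq_integral (EFin \o (Y \- eta))); last first.
    by move=> w /set_mem /YA /ltW; rewrite /= => /ger0_norm ->.
  rewrite -[LHS]fineK; last exact: integrable_fin_num.
  congr EFin; apply/eqP; rewrite eq_le int_le0/=.
  by apply: Rintegral_ge0 => w /YA /ltW.
have mB := measurable_int _ intB.
have /(ae_eq_integral_abs _ mA mB) := int0.
apply: filterS => w YB; apply/negP => /negP nYw.
have Aw : A w by exact/negP.
by have := YB Aw; have := YA _ Aw; rewrite /= => + [] => /[swap] ->; rewrite ltxx.
Qed.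

End constraint.

(** * Primal and dual values of the Lagrangian *)

Section duality.
Variables (R : realType) (d : measure_display) (T : measurableType d).
Variables (C : set (set T)) (C_sub : is_sub_sigma_algebra C).
Local Notation S := (g_sigma_algebraType C).
Local Notation CC := (bounded_measurable S : set (T -> R)).
Local Notation CCplus := [set X | CC X /\ forall w, 0 <= X w].
Variables (rho : (T -> R) -> R) (xi : T -> R).
Hypotheses (rho_sub : sublinear_operator rho) (xi_bd : bounded_measurable T xi).

Definition mean_square (eta : T -> R) : R := rho (fun w => (xi w - eta w) ^+ 2).

Definition lagrangian (eta teta : T -> R) : R :=
  rho (fun w => (xi w - eta w) ^+ 2 + teta w * (xi w - eta w)).

Lemma lagrangian0 eta : lagrangian eta (fun=> 0) = mean_square eta.
Proof. by congr rho; apply/funext => w; rewrite mul0r addr0. Qed.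

Lemma CCplus0 : CCplus (fun=> 0).
Proof. by split=> //; exact: bounded_measurable_cst. Qed.

Lemma bounded_error eta : CC eta -> bounded_measurable T (fun w => xi w - eta w).
Proof.
by move=> beta; apply: bounded_measurableB => //; exact: bounded_measurable_sub beta.
Qed.

Lemma bounded_square_error eta :
  CC eta -> bounded_measurable T (fun w => (xi w - eta w) ^+ 2).
Proof. by move=> beta; exact/bounded_measurableX2/bounded_error. Qed.

Lemma bounded_penalty eta teta : CC eta -> CC teta ->
  bounded_measurable T (fun w => teta w * (xi w - eta w)).
Proof.
move=> beta bteta; apply: bounded_measurableM; last exact: bounded_error.
exact: bounded_measurable_sub bteta.
Qed.

(** Completing the square: the shifted integrand is
(xi - eta)^2 - teta^2 / 4. *)
Lemma lagrangian_shift_le eta teta : CC eta -> CC teta ->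
  lagrangian (fun w => eta w + 2^-1 * teta w) teta <= mean_square eta.
Proof.
move=> beta bteta; case: rho_sub => rho_mono _ _ _.
have bshift : CC (fun w => eta w + 2^-1 * teta w).
  by apply: bounded_measurableD => //; exact: bounded_measurableZ.
apply: rho_mono => [||w]; first exact: bounded_square_error.
  apply: bounded_measurableD; first exact: bounded_square_error.
  exact: bounded_penalty.
rewrite -subr_ge0 (_ : _ - _ = (2^-1 * teta w) ^+ 2) ?sqr_ge0//.
by field.
Qed.

Lemma dual_value :
  ereal_sup [set ereal_inf [set (lagrangian eta teta)%:E | eta in CC]
    | teta in CCplus] =
  ereal_inf [set (mean_square eta)%:E | eta in CC].
Proof.
apply/eqP; rewrite eq_le; apply/andP; split.
  apply: ge_ereal_sup => _ [teta [bteta _] <-].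
  apply: le_ereal_inf_tmp => _ [eta beta <-].
  have bshift : CC (fun w => eta w + 2^-1 * teta w).
    by apply: bounded_measurableD => //; exact: bounded_measurableZ.
  apply: le_trans (ereal_inf_lbound (imageP _ bshift)) _.
  by rewrite lee_fin lagrangian_shift_le.
apply: ereal_sup_ubound; exists (fun=> 0); first exact: CCplus0.
by congr ereal_inf; apply: eq_imagel => eta _; rewrite lagrangian0.
Qed.

Variables (P0 : probability T R) (eta_ess : T -> R).
Hypotheses (rho_cont : continuous_from_above rho)
  (rho_lt : strictly_comparable P0 rho) (ess_bd : CC eta_ess)
  (ess_sup : is_ess_sup_cond_exp P0 (repr_set rho) C xi eta_ess).

Lemma ess_sup_indicM_le0 A : C A -> rho (fun w => \1_A w * (xi w - eta_ess w)) <= 0.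
Proof. by case: ess_sup => _ ub _; exact: sublinear_indicM_le0. Qed.

Lemma ess_sup_multiplier_le0 teta : CCplus teta ->
  rho (fun w => teta w * (xi w - eta_ess w)) <= 0.
Proof.
move=> [bteta teta0]; apply: (sublinear_multiplier_le0 C_sub) => //.
  exact: bounded_error.
exact: ess_sup_indicM_le0.
Qed.

Lemma ess_sup_le_feasible eta : CC eta ->
  (forall A, C A -> rho (fun w => \1_A w * (xi w - eta w)) <= 0) ->
  {ae P0, forall w, eta_ess w <= eta w}.
Proof.
move=> beta eta_feas; case: ess_sup => _ _; apply; first by case: beta.
exact: feasible_cond_exp_upper_bound.
Qed.

(** With delta = eta - eta_ess >= 0 almost surely,
(xi - eta)^2 + 2 delta (xi - eta_ess) - (xi - eta_ess)^2 = delta^2 >= 0.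
The positive part of delta is used as a multiplier, so that it is nonnegative
everywhere. *)
Lemma mean_square_ess_sup_le eta : CC eta ->
  {ae P0, forall w, eta_ess w <= eta w} ->
  mean_square eta_ess <= mean_square eta.
Proof.
move=> beta ess_le; case: rho_sub => _ _ rhoD _.
pose delta w := 2 * Num.max (eta w - eta_ess w) 0.
have bdelta : CCplus delta.
  split=> [|w]; last by rewrite mulr_ge0// le_max lexx orbT.
  exact/bounded_measurableZ/bounded_measurable_max0/bounded_measurableB.
have bsq := bounded_square_error beta.
have bpen := bounded_penalty ess_bd bdelta.1.
apply: (@le_trans _ _ (rho ((fun w => (xi w - eta w) ^+ 2) \+
    (fun w => delta w * (xi w - eta_ess w))))).
  apply: (le_sublinear_ae rho_sub rho_lt).
  - exact: bounded_square_error.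
  - exact: bounded_measurableD.
  - apply: filterS ess_le => w ess_w /=.
    rewrite /delta max_l ?subr_ge0// -subr_ge0.
    rewrite (_ : _ - _ = (eta w - eta_ess w) ^+ 2) ?sqr_ge0//; ring.
apply: le_trans (rhoD _ _ bsq bpen) _.
by rewrite -[leRHS]addr0 lerD2l; exact: ess_sup_multiplier_le0.
Qed.

Lemma lagrangian_ess_sup_le teta : CCplus teta ->
  lagrangian eta_ess teta <= mean_square eta_ess.
Proof.
move=> teta_plus; case: rho_sub => _ _ rhoD _.
apply: le_trans (rhoD _ _ (bounded_square_error ess_bd) (bounded_penalty ess_bd teta_plus.1)) _.
by rewrite -[leRHS]addr0 lerD2l; exact: ess_sup_multiplier_le0.
Qed.

(** The square is nonnegative, so L (eta, t 1_A) >= t rho (1_A (xi - eta)), which is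
unbounded in t. *)
Lemma lagrangian_infeasible eta A (r : R) : CC eta -> C A ->
  0 < rho (fun w => \1_A w * (xi w - eta w)) ->
  exists2 teta, CCplus teta & r <= lagrangian eta teta.
Proof.
move=> beta CA; set v := rho _ => v0.
case: rho_sub => rho_mono _ _ rhoZ.
have t0 : 0 <= `|r| / v by rewrite divr_ge0// ltW.
have b1A : CC (\1_A : T -> R).
  by apply: bounded_measurable_indic; rewrite measurable_subE.
have bteta : CC (fun w => `|r| / v * \1_A w) by exact: bounded_measurableZ.
exists (fun w => `|r| / v * \1_A w).
  by split=> // w; rewrite mulr_ge0// indic_ge0.
apply: (@le_trans _ _ (rho (fun w => `|r| / v * (\1_A w * (xi w - eta w))))).
  rewrite rhoZ//; last exact: bounded_penalty.
  by rewrite -/v divfK ?gt_eqF// ler_norm.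
apply: rho_mono => [||w].
- apply: bounded_measurableD; first exact: bounded_square_error.
  exact: bounded_penalty.
- by apply: bounded_measurableZ; exact: bounded_penalty.
- by rewrite mulrA lerDr sqr_ge0.
Qed.

Lemma primal_value :
  ereal_inf [set ereal_sup [set (lagrangian eta teta)%:E | teta in CCplus]
    | eta in CC] = (mean_square eta_ess)%:E.
Proof.
apply/eqP; rewrite eq_le; apply/andP; split.
  apply: le_trans (ereal_inf_lbound (imageP _ ess_bd)) _.
  apply: ge_ereal_sup => _ [teta teta_plus <-].
  by rewrite lee_fin lagrangian_ess_sup_le.
apply: le_ereal_inf_tmp => _ [eta beta <-].
have [eta_feas|] :=
    pselect (forall A, C A -> rho (fun w => \1_A w * (xi w - eta w)) <= 0).
  apply: le_trans (ereal_sup_ubound (imageP _ CCplus0)).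
  rewrite lee_fin lagrangian0; apply: mean_square_ess_sup_le => //.
  exact: ess_sup_le_feasible.
move=> /existsNP[A /not_implyP[CA /negP]]; rewrite -ltNge => rhoA.
have [teta teta_plus le_teta] := lagrangian_infeasible (mean_square eta_ess) beta CA rhoA.
apply: le_trans (ereal_sup_ubound (imageP _ teta_plus)).
by rewrite lee_fin.
Qed.

End duality.

Theorem theorem5p6 (R : realType) (d : measure_display) (T : measurableType d)
    (C : set (set T)) (hC : is_sub_sigma_algebra C)
    (rho : (T -> R) -> R)
    (hrho : sublinear_operator rho)
    (hcont : continuous_from_above rho)
    (P0 : probability T R) (hP0 : dominating_measure rho P0)
    (hcomp : strictly_comparable P0 rho)
    (F : nat -> set (set T)) (hF : filtration F)
    (hstable : stable P0 F (repr_set rho))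
    (xi : T -> R) (hxi : bounded_measurable T xi)
    (eta_ess : T -> R)
    (heta_bd : bounded_measurable (g_sigma_algebraType C) eta_ess)
    (heta : is_ess_sup_cond_exp P0 (repr_set rho) C xi eta_ess) :
  let CC : set (T -> R) := bounded_measurable (g_sigma_algebraType C) in
  let CCplus : set (T -> R) := [set X | CC X /\ forall w, 0 <= X w] in
  (rho (fun w => (xi w - eta_ess w) ^+ 2))%:E =
    ereal_inf [set (rho (fun w => (xi w - eta w) ^+ 2))%:E | eta in CC]
  <->
  ereal_inf [set ereal_sup
      [set (rho (fun w => (xi w - eta w) ^+ 2
                          + teta w * (xi w - eta w)))%:E | teta in CCplus]
      | eta in CC] =
  ereal_sup [set ereal_inf
      [set (rho (fun w => (xi w - eta w) ^+ 2
                          + teta w * (xi w - eta w)))%:E | eta in CC]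
      | teta in CCplus].
Proof.
move=> CC CCplus.
have primal := primal_value hC hrho hxi hcont hcomp heta_bd heta.
have dual := dual_value hC hrho hxi.
split=> [optimal|minimax].
  exact: etrans primal (etrans optimal (esym dual)).
exact: etrans (esym primal) (etrans minimax dual).
Qed.
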